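(* Let $u_0,u_1\in\overline{\mathbb A}^*$ and $v_0,v_1\in\overline{\mathbb A}^+$ with $|u_0|=|u_1|$. Put $\ell_i=|v_{1-i}|$ and $p_i=u_iv_i^{2\ell_i}$ for $i=0,1$. Then the ultimately periodic bar strings $u_0v_0^\omega$ and $u_1v_1^\omega$ are $\alpha$-equivalent if and only if the finite prefixes $p_0$ and $p_1$ are $\alpha$-equivalent.
   Context: $\mathbb A$ is a fixed countably infinite set of names; $\overline{\mathbb A}=\mathbb A\cup\{\vert a : a\in\mathbb A\}$, where $a$ is a plain name and $\vert a$ a bar name. A bar string is a finite word over $\overline{\mathbb A}$; an infinite bar string is an element of $\overline{\mathbb A}^\omega$; $|w|$ denotes the length of a finite word. Finite permutations $\pi$ of $\mathbb A$ act by $\pi\cdot a=\pi(a)$, $\pi\cdot\vert a=\vert\pi(a)$, and letterwise on words; $(a\ c)$ is the transposition of $a$ and $c$. For finite bar strings $v,u$ write $\langle a\rangle v=\langle b\rangle u$ iff $(a\ c)\cdot v=(b\ c)\cdot u$ for some (equivalently every) name $c\notin\{a,b\}$ not occurring (plain or barred) in $v$ or $u$. $\alpha$-equivalence $\equiv_\alpha$ on finite bar strings is the equivalence relation generated by $w\vert a\,v\equiv_\alpha w\vert b\,u$ whenever $\langle a\rangle v=\langle b\rangle u$. Two infinite bar strings $v,w$ are $\alpha$-equivalent iff for every $n\in\mathbb N$ their prefixes of length $n$ are $\alpha$-equivalent. *)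

(* Defs.v *)
From mathcomp Require Import all_boot.
From Stdlib Require Export Relation_Operators.

Set Implicit Arguments.
Unset Strict Implicit.
Unset Printing Implicit Defensive.

Section BarStrings.

Variable A : eqType.

Inductive letter : Type := Plain of A | Bar of A.

Definition name (l : letter) : A := match l with Plain a | Bar a => a end.

Definition barstring : Type := seq letter.
Definition inf_barstring : Type := nat -> letter.

Definition names (w : barstring) : seq A := map name w.

Definition transp (a c x : A) : A :=
  if x == a then c else if x == c then a else x.

Definition act_letter (pi : A -> A) (l : letter) : letter :=
  match l with Plain a => Plain (pi a) | Bar a => Bar (pi a) end.

Definition act (pi : A -> A) (w : barstring) : barstring :=
  map (act_letter pi) w.

(* <a>v = <b>u *)
Definition abs_eq (a : A) (v : barstring) (b : A) (u : barstring) : Prop :=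
  exists c : A, [/\ c != a, c != b, c \notin names v, c \notin names u
    & act (transp a c) v = act (transp b c) u].

Inductive alpha_step : barstring -> barstring -> Prop :=
  | AlphaStep (w : barstring) (a : A) (v : barstring) (b : A) (u : barstring) :
      abs_eq a v b u -> alpha_step (w ++ Bar a :: v) (w ++ Bar b :: u).

Definition alpha_eq : barstring -> barstring -> Prop :=
  clos_refl_sym_trans barstring alpha_step.

Definition inf_prefix (n : nat) (s : inf_barstring) : barstring := mkseq s n.

Definition inf_alpha_eq (s t : inf_barstring) : Prop :=
  forall n : nat, alpha_eq (inf_prefix n s) (inf_prefix n t).

Definition word_pow (v : barstring) (n : nat) : barstring :=
  flatten (nseq n v).

Definition omega_pow (v : barstring) (v_gt0 : 0 < size v) : inf_barstring :=
  fun n => tnth (in_tuple v) (Ordinal (ltn_pmod n v_gt0)).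

(* The default value of nth is what is returned when size u <= n. *)
Definition prepend (u : barstring) (s : inf_barstring) : inf_barstring :=
  fun n => nth (s (n - size u)) u n.

End BarStrings.

(* Main.v *)
Require Import Defs.
From mathcomp Require Import all_boot.
From mathcomp Require Import zify.

(** Replace every bound plain letter by the position of its binder (the last
    preceding bar letter with that name), every bar letter by a blank, and keep
    free names.  Over infinitely many names, two words are alpha-equivalent iff
    these name-free forms agree letter by letter.  If an infinite word has
    period [m] from position [k] on, then from position [k + m] on the binder of
    position [i + m] is determined by that of [i]: it is the same if it lies
    before [k], and is shifted by [m] otherwise.  Hence agreement of the
    name-free forms on the first [k + 2m] positions propagates, with [m] the
    common period [|v0| * |v1|]. *)

Set Implicit Arguments.
Unset Strict Implicit.
Unset Printing Implicit Defensive.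

Section NameFreeForm.

Variable A : eqType.
Implicit Types (a b c x : A) (l : letter A) (u v w : barstring A).
Implicit Types (s t : inf_barstring A).

(* An environment maps a name to the position of its current binder. *)
Implicit Types (e : A -> option nat).

Definition extend (n : nat) e l : A -> option nat :=
  fun x => if l is Bar b then (if x == b then Some n else e x) else e x.

Definition code e l : option (nat + A) :=
  if l is Plain a then Some (if e a is Some j then inl j else inr a) else None.

Fixpoint nf (n : nat) e w : seq (option (nat + A)) :=
  if w is l :: w' then code e l :: nf n.+1 (extend n e l) w' else [::].

Lemma size_nf n e w : size (nf n e w) = size w.
Proof. by elim: w n e => //= l w IH n e; rewrite IH. Qed.

Lemma transp_inj a c : injective (transp a c).
Proof.
move=> x y; rewrite /transp.
by do ![case: eqP => [->|?]] => //; congruence.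
Qed.

(** Codes record a name only when it is free, so an injective renaming that fixes the free names
    leaves them unchanged. *)
Lemma nf_act (pi : A -> A) n e e' v :
    injective pi ->
    (forall x, x \in names v ->
       e' (pi x) = e x /\ (e x = None -> pi x = x)) ->
  nf n e' (act pi v) = nf n e v.
Proof.
move=> pi_inj; elim: v n e e' => //= l v IH n e e' He; congr cons.
  case: l He => [a|a] He //=.
  have [-> Ha] := He a (mem_head _ _).
  by case E: (e a) => //; rewrite Ha.
apply: IH => x xv.
have [E1 E2] := He x (mem_behead (s := _ :: _) xv).
case: l He => [a|a] He //=.
by rewrite inj_eq //; case: eqP.
Qed.

(** Lets both sides of [abs_eq] be compared through their common renaming with the fresh name
    [c]. *)
Lemma nf_rename n e a c v : c \notin names v ->
  nf n.+1 (extend n e (Bar c)) (act (transp a c) v)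
  = nf n.+1 (extend n e (Bar a)) v.
Proof.
move=> cv; apply: nf_act => [|x xv]; first exact: transp_inj.
have xc : x != c by apply: contraNneq cv => <-.
rewrite /= /transp; case: (x =P a) => [_|_]; first by rewrite eqxx.
by rewrite (negPf xc) (negPf xc).
Qed.

Lemma nf_step n e v w : alpha_step v w -> nf n e v = nf n e w.
Proof.
case=> {}w a x b y [c [_ _ cx cy Exy]].
elim: w n e => [|l w IH] n e /=; last by rewrite IH.
by congr cons; rewrite -(nf_rename n e a cx) Exy nf_rename.
Qed.

Lemma alpha_eq_nf n e v w : alpha_eq v w -> nf n e v = nf n e w.
Proof.
by elim=> [x y /nf_step| | x y _ -> | x y z _ -> _ ->].
Qed.

(** Injectivity lets a bound name be recovered from its binder position; the bound [n] keeps it true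
    when a binder at [n] is added. *)
Definition env_wf (n : nat) e :=
  (forall x j, e x = Some j -> j < n) /\
  (forall x y j, e x = Some j -> e y = Some j -> x = y).

Lemma extend_wf n e l : env_wf n e -> env_wf n.+1 (extend n e l).
Proof.
case: l => [a|a] [lt_e inj_e]; split=> //=.
- by move=> x j /lt_e/ltnW.
- by move=> x j; case: eqP => _ => [[<-] //|/lt_e/ltnW].
move=> x y j; case: (x =P a) => [->|_]; case: (y =P a) => [->|_] //.
- by move=> [<-] /lt_e; rewrite ltnn.
- by move=> /lt_e + [ej]; rewrite -ej ltnn.
- exact: inj_e.
Qed.

Hypothesis A_infinite : forall r : seq A, exists c, c \notin r.

Lemma nf_alpha_eq n e w v u :
  env_wf n e -> nf n e v = nf n e u -> alpha_eq (w ++ v) (w ++ u).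
Proof.
move=> we E; have Es : size v = size u by rewrite -(size_nf n e) E size_nf.
(* Induction is on the length because tails get renamed below; [w] collects the letters already made
   equal. *)
move Em: (size v) => m; elim: m n e w v u we E Es Em => [|m IH] n e w.
  by move=> [|//] [|//] *; apply: rst_refl.
move=> [|l v] // [|l' u] // we /= [Ec Ev] [Es] [Em].
have cons_case : l = l' -> alpha_eq (w ++ l :: v) (w ++ l' :: u).
  move=> El; rewrite -El -!cat_rcons; rewrite -El in Ev.
  exact: (IH _ _ _ _ _ (extend_wf l we) Ev Es Em).
case: l l' Ec Ev cons_case => [a|a] [b|b] //= Ec Ev cons_case.
  apply: cons_case; congr Plain.
  case Ea: (e a) Ec => [j|]; case Eb: (e b) => [j'|] // [Ec] //.
  by rewrite -Ec in Eb; apply: we.2 Ea Eb.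
(* Two bar letters may carry different names: both are renamed to one fresh [c], which makes the
   heads equal. *)
have [c] := A_infinite (a :: b :: names v ++ names u).
rewrite !inE mem_cat !negb_or => /and4P[ca cb cv cu].
have rename x z : c != x -> c \notin names z ->
    alpha_eq (w ++ Bar x :: z) (w ++ Bar c :: act (transp x c) z).
  move=> cx cz; apply: rst_step; constructor.
  have [d] := A_infinite (x :: c :: names z ++ names (act (transp x c) z)).
  rewrite !inE mem_cat !negb_or => /and4P[dx dc dz dz'].
  exists d; split=> //.
  rewrite /act -map_comp; move: cz dz; rewrite /names.
  elim: z {dz'} => //= l z IHz; rewrite !inE !negb_or.
  move=> /andP[cl cz] /andP[dl dz]; congr cons; last exact: IHz.
  (* Away from [c] and [d], moving [x] to [d] is the same as moving it to [c] and then to [d]. *)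
  have E y : c != y -> d != y ->
      transp x d y = transp c d (transp x c y).
    rewrite /transp => cy dy; rewrite !(eq_sym y) (negPf cy) (negPf dy).
    case: (x =P y) => _; first by rewrite eqxx.
    by rewrite !(eq_sym y) (negPf cy) (negPf dy).
  by case: l cl dl => y /= cl dl; rewrite E.
apply: rst_trans (rename a v ca cv) _.
apply: rst_trans (rst_sym _ _ _ _ (rename b u cb cu)).
rewrite -!cat_rcons.
apply: (IH n.+1 (extend n e (Bar c))); rewrite ?size_map //.
  exact: extend_wf.
by rewrite !nf_rename.
Qed.

Lemma alpha_eqP v w :
  alpha_eq v w <-> nf 0 (fun=> None) v = nf 0 (fun=> None) w.
Proof.
split; first exact: alpha_eq_nf.
by apply: (@nf_alpha_eq _ _ [::]).
Qed.

Fixpoint env s (n : nat) : A -> option nat :=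
  if n is n'.+1 then extend n' (env s n') (s n') else fun=> None.

Definition code_at s i := code (env s i) (s i).

Lemma nf_mkseq s n : nf 0 (fun=> None) (mkseq s n) = mkseq (code_at s) n.
Proof.
rewrite /mkseq -[fun=> None]/(env s 0).
by elim: n (0) => //= n IH k; rewrite -IH.
Qed.

Lemma alpha_eq_prefixP s t n :
  alpha_eq (inf_prefix n s) (inf_prefix n t)
  <-> (forall i, i < n -> code_at s i = code_at t i).
Proof.
rewrite alpha_eqP !nf_mkseq; split=> [E i lt_in | E].
  by rewrite -(nth_mkseq None (code_at s) lt_in) E nth_mkseq.
by apply/eq_in_map => i; rewrite mem_iota => /E.
Qed.

Lemma env_lt s n x j : env s n x = Some j -> j < n.
Proof.
elim: n => //= n IH; rewrite /extend; case: (s n) => [_|b].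
  by move/IH/ltnW.
by case: eqP => [_ [<-]|_ /IH/ltnW].
Qed.

Section Periodic.

Variables (k m : nat).

Definition shift_pos (j : nat) : nat := if j < k then j else j + m.

Definition shift_code (q : option (nat + A)) : option (nat + A) :=
  if q is Some (inl j) then Some (inl (shift_pos j)) else q.

Definition periodic_from s := forall i, k <= i -> s (i + m) = s i.

(** The bound cannot be lowered to [k]: a name free or bound before [k] may be rebound during the
    first period. *)
Lemma env_shift s i x : periodic_from s -> k + m <= i ->
  env s (i + m) x = omap shift_pos (env s i x).
Proof.
move=> per /subnKC <-; move: (i - _) => d {i}.
elim: d => [|d IHd]; last first.
  rewrite addnS !addSn /= per; last by lia.
  rewrite /extend; case: (s _) => // b; case: eqP => //= _.
  by rewrite /shift_pos; case: ltnP => //; lia.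
rewrite addn0.
(* Reading on from [k] and from [k + m], one meets the same letters: the two
   environments correspond for binders met on the way, and otherwise the second
   one is still as it was at [k + m]. *)
have base d : env s (k + d + m) x =
    if env s (k + d) x is Some j then
      if j < k then env s (k + m) x else Some (j + m)
    else env s (k + m) x.
  elim: d => [|d IHd].
    by rewrite addn0; case E: (env s k x) => [j|//]; rewrite (env_lt E).
  rewrite addnS addSn /= per ?leq_addr // /extend.
  by case: (s _) => // b; case: eqP => // _; rewrite ltnNge leq_addr.
(* At [d = m] both sides of [base] speak of the environment at [k + m]. *)
rewrite base; case E: (env s (k + m) x) => [j|] //=.
by rewrite /shift_pos; case: ifP.
Qed.

Lemma code_at_shift s i : periodic_from s -> k + m <= i ->
  code_at s (i + m) = shift_code (code_at s i).
Proof.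
move=> per le_i; rewrite /code_at per; last by lia.
by case: (s i) => //= a; rewrite env_shift //; case: (env s i a).
Qed.

(** For [i >= k + 2 * m], position [i - m] is at least [k + m], so both codes at [i] arise from
    those at [i - m] by the same [shift_code]. *)
Lemma periodic_code_at_eq s t : 0 < m -> periodic_from s -> periodic_from t ->
    (forall i, i < k + 2 * m -> code_at s i = code_at t i) ->
  forall i, code_at s i = code_at t i.
Proof.
move=> m_gt0 per_s per_t E; elim/ltn_ind=> i IH.
have [/E //|le_i] := ltnP i (k + 2 * m).
have <- : i - m + m = i by lia.
by rewrite !code_at_shift ?IH //; lia.
Qed.

End Periodic.

End NameFreeForm.

Section UltimatelyPeriodic.

Variable A : eqType.
Implicit Types (u v : barstring A).

Lemma size_word_pow v n : size (word_pow v n) = n * size v.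
Proof. by elim: n => //= n IH; rewrite size_cat IH mulSn. Qed.

Lemma nth_word_pow x0 v n i : i < n * size v ->
  nth x0 (word_pow v n) i = nth x0 v (i %% size v).
Proof.
elim: n i => //= n IH i; rewrite mulSn nth_cat => lt_i.
case: ltnP => [/modn_small -> // | le_vi].
rewrite IH; last by lia.
by rewrite -{2}(subnK le_vi) modnDr.
Qed.

Lemma inf_prefix_prepend_omega u v (v_gt0 : 0 < size v) n :
  inf_prefix (size u + n * size v) (prepend u (omega_pow v_gt0))
  = u ++ word_pow v n.
Proof.
(* Since [v] is nonempty, a default letter is available. *)
have x0 : letter A := omega_pow v_gt0 0.
apply: (@eq_from_nth _ x0).
  by rewrite size_mkseq size_cat size_word_pow.
move=> i; rewrite size_mkseq => lt_i; rewrite nth_mkseq // nth_cat /prepend.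
case: ltnP => [lt_iu | le_ui]; first exact: set_nth_default.
rewrite nth_default // nth_word_pow; last by lia.
by rewrite /omega_pow (tnth_nth x0).
Qed.

Lemma periodic_prepend_omega u v (v_gt0 : 0 < size v) m : size v %| m ->
  periodic_from (size u) m (prepend u (omega_pow v_gt0)).
Proof.
move=> /dvdnP[q ->] i le_ui; rewrite /prepend !nth_default //; last by lia.
rewrite /omega_pow; congr tnth; apply: val_inj => /=.
by rewrite -addnBAC // addnC modnMDl.
Qed.

End UltimatelyPeriodic.

(** Pigeonhole: [size r + 1] distinct values of [f] cannot all lie in [r]. *)
Lemma fresh_name (A : eqType) (f : nat -> A) (r : seq A) :
  injective f -> exists c, c \notin r.
Proof.
move=> f_inj; pose fs := mkseq f (size r).+1.
have /allPn[c _ cr] : ~~ all (mem r) fs.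
  apply/allP => sub_fs; have := uniq_leq_size (mkseq_uniq _ f_inj) sub_fs.
  by rewrite size_mkseq ltnn.
by exists c.
Qed.

Theorem proposition4p5 (A : eqType)
    (A_countably_infinite : exists f : nat -> A, bijective f)
    (u0 u1 v0 v1 : barstring A)
    (v0_gt0 : 0 < size v0) (v1_gt0 : 0 < size v1)
    (size_u : size u0 = size u1) :
  let l0 := size v1 in
  let l1 := size v0 in
  let p0 := u0 ++ word_pow v0 (2 * l0) in
  let p1 := u1 ++ word_pow v1 (2 * l1) in
  inf_alpha_eq (prepend u0 (omega_pow v0_gt0)) (prepend u1 (omega_pow v1_gt0))
  <-> alpha_eq p0 p1.
Proof.
have [f /bij_inj f_inj] := A_countably_infinite.
have fresh r : exists c, c \notin r := fresh_name r f_inj.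
move=> l0 l1 p0 p1; pose m := size v0 * size v1.
rewrite /p0 /p1 -(inf_prefix_prepend_omega u0 v0_gt0).
rewrite -(inf_prefix_prepend_omega u1 v1_gt0) -size_u.
(* Both prefixes have length [size u0 + 2 * m], the bound of [periodic_code_at_eq] for
   [k = size u0]. *)
have -> : 2 * l0 * size v0 = 2 * m by rewrite /m /l0; lia.
have -> : 2 * l1 * size v1 = 2 * m by rewrite /m /l1; lia.
split=> [|/(alpha_eq_prefixP fresh) E n]; first exact.
apply/(alpha_eq_prefixP fresh) => i _.
apply: (periodic_code_at_eq _ _ _ E); first by rewrite muln_gt0 v0_gt0.
  by apply: periodic_prepend_omega; apply: dvdn_mulr.
by rewrite size_u; apply: periodic_prepend_omega; apply: dvdn_mull.
Qed.
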